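(* Let $(A,\succ,\prec,\rho)$ be a quadratic Leibniz-dendriform algebra with $a\circ b:=a\succ b+a\prec b$, let $(B,\diamond)$ be a Zinbiel algebra with a non-degenerate bilinear form $\nu$, and let $(A\otimes B,\cdot)$ be the pre-Lie algebra with product $$(a\otimes x)\cdot(b\otimes y)=(a\succ b)\otimes (x\diamond y)-(b\prec a)\otimes (y\diamond x).$$ Define a bilinear form $\omega$ on $A\otimes B$ by $\omega(a\otimes x,b\otimes y)=\rho(a,b)\nu(x,y)$ for $a,b\in A$, $x,y\in B$. Then $(A\otimes B,\cdot,\omega)$ is a quadratic pre-Lie algebra if and only if $\nu$ is skew-symmetric and for all $a,b,c\in A$, $x,y,z\in B$: $$\rho(b,a\circ c)\big(\nu(y,x\diamond z)-\nu(x\diamond y,z)-\nu(y\diamond x,z)\big)-\rho(b,c\circ a)\big(\nu(y\diamond x,z)+\nu(y,z\diamond x)\big)=0.$$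
   Context: All vector spaces are over a field $\mathbb K$. Standing convention of the paper: algebras are finite-dimensional. Leibniz-dendriform algebra $(A,\succ,\prec)$: two bilinear operations such that, with $x\circ y:=x\succ y+x\prec y$, for all $x,y,z$: $(x\circ y)\succ z=x\succ(y\succ z)-y\succ(x\succ z)$; $y\prec(x\circ z)+(x\succ y)\prec z=x\succ(y\prec z)$; $x\prec(y\circ z)=(x\prec y)\prec z+y\succ(x\prec z)$. It is quadratic if equipped with a non-degenerate symmetric bilinear form $\rho$ with $\rho(x\prec y,z)=\rho(x,y\circ z+z\circ y)$ and $\rho(x\succ y,z)=-\rho(y,x\circ z)$ for all $x,y,z\in A$. (Left) Zinbiel algebra $(B,\diamond)$: $x\diamond(y\diamond z)=(x\diamond y)\diamond z+(y\diamond x)\diamond z$. Pre-Lie algebra $(L,\cdot)$: $(x\cdot y)\cdot z-x\cdot(y\cdot z)=(y\cdot x)\cdot z-y\cdot(x\cdot z)$. A quadratic pre-Lie algebra is a pre-Lie algebra $(L,\cdot)$ with a non-degenerate skew-symmetric bilinear form $\omega$ such that $\omega(x\cdot y,z)=-\omega(y,[x,z])$ for all $x,y,z\in L$, where $[x,z]=x\cdot z-z\cdot x$.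
   Formalization: The formal statement assumes A ≠ 0: for A = 0 the space A⊗B is zero and trivially a quadratic pre-Lie algebra, while ν may be non-degenerate without being skew-symmetric, so the ''only if'' direction fails. *)

(* Defs.v *)
From HB Require Import structures.
From mathcomp Require Import all_boot all_order all_algebra.

Set Implicit Arguments.
Unset Strict Implicit.
Unset Printing Implicit Defensive.

Import GRing.Theory VectorInternalTheory.
Local Open Scope ring_scope.

Section Forms.
Variables (K : fieldType) (V : vectType K) (f : {biscalar V}).

(* Both radicals are required to vanish, since [f] need be neither symmetric
   nor skew-symmetric; sesquilinear.nondegenerate applies to hermitian forms
   only. *)
Definition nondegenerate_form : Prop :=
  (forall x : V, (forall y : V, f x y = 0) -> x = 0) /\
  (forall y : V, (forall x : V, f x y = 0) -> y = 0).

Definition symmetric_form : Prop := forall x y : V, f x y = f y x.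

(* In characteristic 2 this is weaker than being alternating. *)
Definition skew_symmetric_form : Prop := forall x y : V, f x y = - f y x.

End Forms.

Section Algebras.
Variables (K : fieldType) (V : vectType K).

Definition circ (succ prec : V -> V -> V) (x y : V) : V := succ x y + prec x y.

Definition leibniz_dendriform (succ prec : {bilinear V -> V -> V}) : Prop :=
  let o := circ succ prec in
  [/\ forall x y z, succ (o x y) z = succ x (succ y z) - succ y (succ x z),
      forall x y z, prec y (o x z) + prec (succ x y) z = succ x (prec y z)
    & forall x y z, prec x (o y z) = prec (prec x y) z + succ y (prec x z)].

Definition quadratic_leibniz_dendriform
    (succ prec : {bilinear V -> V -> V}) (rho : {biscalar V}) : Prop :=
  let o := circ succ prec in
  [/\ leibniz_dendriform succ prec,
      nondegenerate_form rho,
      symmetric_form rho,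
      forall x y z, rho (prec x y) z = rho x (o y z + o z y)
    & forall x y z, rho (succ x y) z = - rho y (o x z)].

Definition zinbiel (dia : {bilinear V -> V -> V}) : Prop :=
  forall x y z, dia x (dia y z) = dia (dia x y) z + dia (dia y x) z.

Definition pre_lie (dot : {bilinear V -> V -> V}) : Prop :=
  forall x y z,
    dot (dot x y) z - dot x (dot y z) = dot (dot y x) z - dot y (dot x z).

Definition quadratic_pre_lie
    (dot : {bilinear V -> V -> V}) (omega : {biscalar V}) : Prop :=
  [/\ pre_lie dot,
      nondegenerate_form omega,
      skew_symmetric_form omega
    & forall x y z, omega (dot x y) z = - omega y (dot x z - dot z x)].

End Algebras.

(* [T], with [tens a x] standing for a (x) x, is a tensor product of [A] and
   [B]: the universal property, which determines (T, tens) up to a unique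
   isomorphism. *)
Definition is_tensor_product (K : fieldType) (A B T : vectType K)
    (tens : {bilinear A -> B -> T}) : Prop :=
  forall (W : lmodType K) (f : {bilinear A -> B -> W}),
    exists g : {linear T -> W},
      (forall a x, g (tens a x) = f a x) /\
      (forall h : {linear T -> W},
         (forall a x, h (tens a x) = f a x) -> forall t, h t = g t).

(* Tensor products exist, and maps that are linear in each of a, x, b, y
   factor through pairs (a (x) x, b (x) y) : the product and the form on
   A (x) B given by their values on pure tensors are thus well defined. *)

Section Coordinates.
Variables (K : fieldType) (V : vectType K).

Definition std_vec (i : 'I_(dim V)) : V := r2v (delta_mx 0 i).

Lemma std_vec_sum (v : V) : v = \sum_i v2r v 0 i *: std_vec i.
Proof.
rewrite -[LHS]v2rK [X in r2v X]row_sum_delta linear_sum.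
by apply: eq_bigr => i _; rewrite linearZ.
Qed.

Lemma linear_std_vec (W : lmodType K) (f : {linear V -> W}) (v : V) :
  f v = \sum_i v2r v 0 i *: f (std_vec i).
Proof.
rewrite {1}(std_vec_sum v) linear_sum.
by apply: eq_bigr => i _; rewrite linearZ.
Qed.

End Coordinates.

Section Existence.
Variables (K : fieldType) (A B : vectType K).

Definition mx_tensor (a : A) (x : B) : 'M[K]_(dim A, dim B) :=
  (v2r a)^T *m v2r x.

Lemma mx_tensor_is_bilinear : bilinear_for *:%R *:%R mx_tensor.
Proof.
split=> u c v w; rewrite /mx_tensor.
  by rewrite !linearP /= mulmxDl -scalemxAl.
by rewrite linearP /= mulmxDr -scalemxAr.
Qed.
HB.instance Definition _ :=
  bilinear_isBilinear.Build K A B 'M[K]_(dim A, dim B) *:%R *:%R mx_tensor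
    mx_tensor_is_bilinear.

Lemma mx_tensorE a x i j : mx_tensor a x i j = v2r a 0 i * v2r x 0 j.
Proof. by rewrite mxE big_ord1 mxE. Qed.

Lemma mx_tensor_std i j :
  mx_tensor (std_vec i) (std_vec j) = delta_mx i j.
Proof. by rewrite /mx_tensor /std_vec !r2vK trmx_delta mul_delta_mx. Qed.

Lemma bilinear_std_vec (W : lmodType K) (f : {bilinear A -> B -> W}) a x :
  f a x = \sum_i \sum_j (v2r a 0 i * v2r x 0 j) *: f (std_vec i) (std_vec j).
Proof.
rewrite -[f a x]/(applyr f x a) linear_std_vec; apply: eq_bigr => i _ /=.
rewrite /applyr [f _ x]linear_std_vec scaler_sumr.
by apply: eq_bigr => j _; rewrite scalerA.
Qed.

Section Lift.
Variables (W : lmodType K) (f : A -> B -> W).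
Definition mx_tensor_lift (M : 'M[K]_(dim A, dim B)) : W :=
  \sum_i \sum_j M i j *: f (std_vec i) (std_vec j).
Lemma mx_tensor_lift_is_linear : linear mx_tensor_lift.
Proof.
move=> c M N; rewrite /mx_tensor_lift scaler_sumr -big_split /=.
apply: eq_bigr => i _; rewrite scaler_sumr -big_split /=.
by apply: eq_bigr => j _; rewrite !mxE scalerDl scalerA.
Qed.
HB.instance Definition _ :=
  GRing.isLinear.Build K 'M[K]_(dim A, dim B) W *:%R mx_tensor_lift
    mx_tensor_lift_is_linear.
End Lift.

Lemma mx_tensor_lift_fun (W : lmodType K) (f g h : A -> B -> W) c M :
  (forall a x, f a x = c *: g a x + h a x) ->
  mx_tensor_lift f M = c *: mx_tensor_lift g M + mx_tensor_lift h M.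
Proof.
move=> fE; rewrite /mx_tensor_lift scaler_sumr -big_split /=.
apply: eq_bigr => i _; rewrite scaler_sumr -big_split /=.
by apply: eq_bigr => j _; rewrite fE scalerDr !scalerA mulrC.
Qed.

Lemma mx_tensorP : is_tensor_product mx_tensor.
Proof.
move=> W f; exists (mx_tensor_lift f); split=> [a x | h hE M] /=.
  rewrite /mx_tensor_lift [RHS]bilinear_std_vec.
  by apply: eq_bigr => i _; apply: eq_bigr => j _; rewrite mx_tensorE.
rewrite {1}(matrix_sum_delta M) linear_sum; apply: eq_bigr => i _.
rewrite linear_sum; apply: eq_bigr => j _.
by rewrite linearZ -mx_tensor_std hE.
Qed.

Lemma tensor_product_exists :
  exists (T : vectType K) (tens : {bilinear A -> B -> T}),
    is_tensor_product tens.
Proof. by exists 'M[K]_(dim A, dim B), mx_tensor; apply: mx_tensorP. Qed.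

Variables (T : vectType K) (tens : {bilinear A -> B -> T}).
Hypothesis tensP : is_tensor_product tens.

Lemma tensor_pair_ext (W : lmodType K) (F : A -> B -> A -> B -> W) :
  (forall a x, bilinear_for *:%R *:%R (F a x)) ->
  (forall b y, bilinear_for *:%R *:%R (fun a x => F a x b y)) ->
  exists G : {bilinear T -> T -> W},
    forall a x b y, G (tens a x) (tens b y) = F a x b y.
Proof.
move=> Fr Fl.
have [phi [phiE _]] := tensP mx_tensor.
pose G0 t s := mx_tensor_lift (fun a x => mx_tensor_lift (F a x) (phi s)) (phi t).
have G0b : bilinear_for *:%R *:%R G0.
  split=> u c v w; rewrite /G0; first by rewrite !linearP.
  by apply: mx_tensor_lift_fun => a x; rewrite !linearP.
pose mG := bilinear_isBilinear.Build K T T W *:%R *:%R G0 G0b.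
pose G : {bilinear T -> T -> W} := HB.pack G0 mG.
exists G => a x b y; rewrite /= /G0 !phiE.
have liftE (f : A -> B -> W) (fb : bilinear_for *:%R *:%R f) a' x' :
    mx_tensor_lift f (mx_tensor a' x') = f a' x'.
  pose mf := bilinear_isBilinear.Build K A B W *:%R *:%R f fb.
  pose f' : {bilinear A -> B -> W} := HB.pack f mf.
  rewrite /mx_tensor_lift -[RHS]/(f' a' x') [RHS]bilinear_std_vec.
  by apply: eq_bigr => i _; apply: eq_bigr => j _; rewrite mx_tensorE.
rewrite -[RHS](liftE _ (Fl b y)); apply: eq_bigr => i _; apply: eq_bigr => j _.
by rewrite liftE.
Qed.

Lemma tensor_mul_exists (succ prec : {bilinear A -> A -> A})
    (dia : {bilinear B -> B -> B}) :
  exists dot : {bilinear T -> T -> T}, forall a b x y,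
    dot (tens a x) (tens b y)
      = tens (succ a b) (dia x y) - tens (prec b a) (dia y x).
Proof.
have [||G GE] := tensor_pair_ext (F := fun a x b y =>
    tens (succ a b) (dia x y) - tens (prec b a) (dia y x)); last first.
- by exists G => a b x y; rewrite GE.
- move=> b y; split=> u c v w;
    rewrite ?linearPl ?linearPr /= ?linearPl ?linearPr /= ;
    by rewrite scalerBr opprD addrACA.
- move=> b y; split=> u c v w;
    rewrite ?linearPl ?linearPr /= ?linearPl ?linearPr /= ;
    by rewrite scalerBr opprD addrACA.
Qed.

Lemma tensor_form_exists (rho : {biscalar A}) (nu : {biscalar B}) :
  exists omega : {biscalar T}, forall a b x y,
    omega (tens a x) (tens b y) = rho a b * nu x y.
Proof.
have [||G GE] := tensor_pair_ext (W := K^o)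
  (F := fun a x b y => rho a b * nu x y : K^o).
- move=> a x; split=> u c v w /=.
    by rewrite linearPr /= mulrDl -mulrA.
  by rewrite linearPr /= mulrDr mulrCA.
- move=> a x; split=> u c v w /=.
    by rewrite linearPl /= mulrDl -mulrA.
  by rewrite linearPl /= mulrDr mulrCA.
have Gb : bilinear_for *%R *%R (G : T -> T -> K).
  by split=> u c v w; rewrite ?linearPl ?linearPr.
pose mG := bilinear_isBilinear.Build K T T K *%R *%R (G : T -> T -> K) Gb.
pose G' : {biscalar T} := HB.pack (G : T -> T -> K) mG.
by exists G' => a b x y; rewrite /= GE.
Qed.

End Existence.

(* Main.v *)
(* Testing invariance of omega on pure tensors and moving every product of A
   into the second slot of rho turns it, term by term, into the displayed
   identity; the identities and the skew-symmetry extend to all of T because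
   pure tensors generate it additively.  Nondegeneracy of omega follows by
   writing t = sum_i e_i (x) x_i with (e_i) a basis of A: nondegeneracy of rho
   isolates nu(x_i, y) for each i, and that of nu then kills each x_i. *)
Require Import Defs.
From mathcomp Require Import all_boot all_order all_algebra.
From mathcomp Require Import ring.

Import GRing.Theory VectorInternalTheory.
Local Open Scope ring_scope.

Lemma std_vec_free (K : fieldType) (V : vectType K) (c : 'I_(dim V) -> K) :
  \sum_i c i *: std_vec i = 0 :> V -> forall i, c i = 0.
Proof.
have -> : \sum_i c i *: std_vec i = r2v (\row_i c i) :> V.
  by rewrite [RHS]std_vec_sum; apply: eq_bigr => i _; rewrite r2vK mxE.
move=> /(congr1 v2r); rewrite r2vK linear0 => c0 i.
by move/rowP: c0 => /(_ i); rewrite !mxE.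
Qed.

(* Reduces an identity of vectors to one in K, where [ring] applies. *)
Lemma vect_functional_ext (K : fieldType) (V : vectType K) (u v : V) :
  (forall f : V -> K, {morph f : x y / x + y} -> {morph f : x / - x} ->
     f u = f v) -> u = v.
Proof.
move=> fE; apply: (can_inj v2rK); apply/rowP => k.
by apply: (fE (fun w => v2r w 0 k)) => [x y | x]; rewrite ?linearD ?linearN mxE.
Qed.

Section TensorProduct.
Variables (K : fieldType) (A B T : vectType K) (tens : {bilinear A -> B -> T}).
Hypothesis tensP : is_tensor_product tens.

(** The matrix model carries the decomposition: [phi] sends [T] to matrices, [psi] sends matrices
    back to [T], and a matrix splits into its rows. *)
Lemma tensor_decomp (t : T) :
  exists x : 'I_(dim A) -> B, t = \sum_i tens (std_vec i) (x i).
Proof.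
have [phi [phiE _]] := tensP _ (@mx_tensor K A B).
have [psi [psiE _]] := @mx_tensorP K A B _ tens.
have [g [_ g_uniq]] := tensP _ tens.
(* Both [idfun] and [psi \o phi] fix pure tensors, so the uniqueness half of the universal property
   identifies them. *)
have tE : t = psi (phi t).
  have idE : t = g t by apply: (g_uniq idfun).
  have phiK a x : psi (phi (tens a x)) = tens a x by rewrite phiE psiE.
  by rewrite [LHS]idE -(g_uniq (psi \o phi) phiK).
(* Row [i] of [phi t] holds the coordinates of the [i]-th component in [B]. *)
exists (fun i => \sum_j phi t i j *: std_vec j).
rewrite [LHS]tE {1}(matrix_sum_delta (phi t)) linear_sum.
apply: eq_bigr => i _; rewrite !linear_sum; apply: eq_bigr => j _.
by rewrite !linearZ /= -mx_tensor_std psiE.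
Qed.

(** Closure under scaling is not asked for: scalars are absorbed into the factor from [B]. *)
Lemma tensor_ind (P : T -> Prop) :
  P 0 -> (forall t u, P t -> P u -> P (t + u)) ->
  (forall a x, P (tens a x)) -> forall t, P t.
Proof.
move=> P0 PD Ptens t; have [x ->] := tensor_decomp t.
by apply: (big_ind P).
Qed.

Lemma tensor_form_radical0 (rho : {biscalar A}) (nu : {biscalar B})
    (omega : {biscalar T}) :
  (forall a b x y, omega (tens a x) (tens b y) = rho a b * nu x y) ->
  (forall a, (forall b, rho a b = 0) -> a = 0) ->
  (forall x, (forall y, nu x y = 0) -> x = 0) ->
  forall t, (forall u, omega t u = 0) -> t = 0.
Proof.
move=> omegaE rho_nd nu_nd t; have [x ->] := tensor_decomp t => t0.
apply: big1 => i _; rewrite (nu_nd (x i)) ?linear0r // => y.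
(* The vector of [A] with coordinates [nu (x i) y] lies in the left radical of [rho], because
   pairing it with [b] gives [omega t (tens b y)]. *)
apply: (std_vec_free _ A (fun i => nu (x i) y)); apply: rho_nd => b.
apply: etrans (t0 (tens b y)); rewrite !linear_sumlz; apply: eq_bigr => j _.
by rewrite linearZl_LR omegaE /= mulrC.
Qed.

Section PreLie.
Variables (succ prec : {bilinear A -> A -> A}) (dia : {bilinear B -> B -> B}).
Variable dot : {bilinear T -> T -> T}.
Hypothesis dotE : forall a b x y, dot (tens a x) (tens b y)
  = tens (succ a b) (dia x y) - tens (prec b a) (dia y x).

Lemma tensor_pre_lie :
  leibniz_dendriform succ prec -> zinbiel dia -> pre_lie dot.
Proof.
move=> [ax1 ax2 ax3] zin.
(* The axioms are oriented as rewrite rules: among left-nested products in [A], only the form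
   [succ (prec a b) c] survives. *)
have succ_succ a b c :
    succ (succ a b) c
      = succ a (succ b c) - succ b (succ a c) - succ (prec a b) c.
  by rewrite -ax1 /circ linearDl addrK.
have prec_succ a b c : prec (succ a c) b
    = succ a (prec c b) - prec c (succ a b) - prec c (prec a b).
  by rewrite -ax2 /circ linearDr -addrA -opprD addrC addKr.
have prec_prec a b c : prec (prec c a) b
    = prec c (succ a b) + prec c (prec a b) - succ a (prec c b).
  by rewrite -linearDr [X in X - _]ax3 addrK.
elim/tensor_ind.
- by move=> u v; rewrite !(linear0l, linear0r) !subr0.
- move=> t1 t2 IH1 IH2 u v; rewrite !(linearDl, linearDr) /=.
  by rewrite !opprD addrACA IH1 IH2 addrACA.
move=> a x; elim/tensor_ind.
- by move=> v; rewrite !(linear0l, linear0r) !subr0.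
- move=> t1 t2 IH1 IH2 v; rewrite !(linearDl, linearDr) /=.
  by rewrite !opprD addrACA IH1 IH2 addrACA.
move=> b y; elim/tensor_ind.
- by rewrite !(linear0l, linear0r) !subr0.
- move=> t1 t2 IH1 IH2; rewrite !(linearDl, linearDr) /=.
  by rewrite !opprD addrACA IH1 IH2 addrACA.
move=> c z; rewrite !dotE !(linearBl, linearBr) /= !dotE.
(* The Zinbiel rule leaves only the six monomials (uv)w of B, and each of the
   three rules for A makes the coefficients of two of them cancel. *)
rewrite !succ_succ !prec_succ !prec_prec !zin.
rewrite !(linearBl, linearDl, linearBr, linearDr) /=.
(* Pure tensors become opaque atoms, leaving an identity in the additive group of [T]. *)
repeat move: (tens _ _) => ?.
apply: vect_functional_ext => f fD fN.
rewrite !(fD, fN); ring.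
Qed.

Lemma tensor_form_invariant (rho : {biscalar A}) (nu : {biscalar B})
    (omega : {biscalar T}) :
  (forall a b x y, omega (tens a x) (tens b y) = rho a b * nu x y) ->
  quadratic_leibniz_dendriform succ prec rho ->
  (forall t u v, omega (dot t u) v = - omega u (dot t v - dot v t)) <->
  (forall a b c x y z,
     rho b (circ succ prec a c) * (nu y (dia x z) - nu (dia x y) z - nu (dia y x) z)
     - rho b (circ succ prec c a) * (nu (dia y x) z + nu y (dia z x)) = 0).
Proof.
move=> omegaE [_ _ _ rho_prec rho_succ].
(* The displayed expression equals the defect of invariance on pure tensors, so each vanishes
   exactly when the other does. *)
have defect a b c x y z :
    rho b (circ succ prec a c) * (nu y (dia x z) - nu (dia x y) z - nu (dia y x) z)
    - rho b (circ succ prec c a) * (nu (dia y x) z + nu y (dia z x))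
    = omega (dot (tens a x) (tens b y)) (tens c z)
      + omega (tens b y) (dot (tens a x) (tens c z) - dot (tens c z) (tens a x)).
  rewrite !dotE !(linearBl, linearBr) /= !omegaE rho_succ rho_prec /circ.
  rewrite !linearDr /=; ring.
split=> [inv a b c x y z | inv]; first by rewrite defect inv addNr.
elim/tensor_ind.
- by move=> u v; rewrite !(linear0l, linear0r, subr0, oppr0).
- move=> t1 t2 IH1 IH2 u v; rewrite !(linearDl, linearDr) /= IH1 IH2.
  by rewrite !(linearDl, linearDr, linearNr) /=; ring.
move=> a x; elim/tensor_ind.
- by move=> v; rewrite !(linear0l, linear0r) oppr0.
- move=> t1 t2 IH1 IH2 v; rewrite linearDr !linearDl /=.
  by rewrite IH1 IH2 opprD.
move=> b y; elim/tensor_ind.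
- by rewrite !(linear0l, linear0r, subr0, oppr0).
- move=> t1 t2 IH1 IH2; rewrite linearDr IH1 IH2.
  by rewrite !(linearDl, linearDr, linearNr) /=; ring.
by move=> c z; apply/eqP; rewrite -addr_eq0 -defect inv.
Qed.

End PreLie.

(* [symmetric_form] alone would denote a notation of sesquilinear.v. *)
Lemma tensor_form_skew (rho : {biscalar A}) (nu : {biscalar B})
    (omega : {biscalar T}) :
  (forall a b x y, omega (tens a x) (tens b y) = rho a b * nu x y) ->
  (exists a b, rho a b != 0) -> Defs.symmetric_form rho ->
  skew_symmetric_form omega <-> skew_symmetric_form nu.
Proof.
move=> omegaE [a0 [b0 rho0]] rhoC; split=> [skew x y | skew].
  have := skew (tens a0 x) (tens b0 y).
  (* The nonzero factor [rho a0 b0] cancels, leaving the identity for [nu]. *)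
  by rewrite !omegaE (rhoC b0) -mulrN => /(mulfI rho0).
elim/tensor_ind=> [u | t1 t2 IH1 IH2 u | a x].
- by rewrite linear0l linear0r oppr0.
- by rewrite linearDl linearDr /= IH1 IH2 opprD.
elim/tensor_ind=> [| t1 t2 IH1 IH2 | b y].
- by rewrite linear0l linear0r oppr0.
- by rewrite linearDl linearDr /= IH1 IH2 opprD.
by rewrite !omegaE rhoC skew mulrN.
Qed.

End TensorProduct.

Theorem proposition2p17
  (K : fieldType) (A B : vectType K)
  (succ prec : {bilinear A -> A -> A}) (rho : {biscalar A})
  (dia : {bilinear B -> B -> B}) (nu : {biscalar B})
  (T : vectType K) (tens : {bilinear A -> B -> T})
  (dot : {bilinear T -> T -> T}) (omega : {biscalar T})
  (A_neq0 : exists a : A, a != 0)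
  (A_quadratic : quadratic_leibniz_dendriform succ prec rho)
  (B_zinbiel : zinbiel dia)
  (nu_nondegenerate : nondegenerate_form nu)
  (T_tensor : is_tensor_product tens)
  (dotE : forall (a b : A) (x y : B),
     dot (tens a x) (tens b y)
       = tens (succ a b) (dia x y) - tens (prec b a) (dia y x))
  (omegaE : forall (a b : A) (x y : B),
     omega (tens a x) (tens b y) = rho a b * nu x y) :
  quadratic_pre_lie dot omega <->
  skew_symmetric_form nu /\
  (forall (a b c : A) (x y z : B),
     rho b (circ succ prec a c) * (nu y (dia x z) - nu (dia x y) z - nu (dia y x) z)
     - rho b (circ succ prec c a) * (nu (dia y x) z + nu y (dia z x)) = 0).
Proof.
have [dendriform [rho_nd _] rhoC _ _] := A_quadratic.
have skewE : skew_symmetric_form omega <-> skew_symmetric_form nu.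
  apply: (tensor_form_skew _ _ _ _ _ T_tensor _ _ _ omegaE) rhoC.
  have [a a0] := A_neq0; exists a.
  (* Testing [a] against a finite basis makes the search for a partner decidable; if every test gave
     zero, [a] would lie in the radical of [rho]. *)
  have [/existsP[i ?] | /existsPn rho_a] :=
    boolP [exists i, rho a (std_vec i) != 0]; first by exists (std_vec i).
  case/eqP: a0; apply: rho_nd => b; rewrite [b]std_vec_sum linear_sumr.
  by apply: big1 => i _; rewrite linearZr_LR (eqP (negbNE (rho_a i))) mulr0.
have invE := tensor_form_invariant _ _ _ _ _ T_tensor _ _ _ _ dotE _ _ _ omegaE
  A_quadratic.
split=> [[_ _ /skewE nu_skew /invE inv] // | [nu_skew /invE inv]].
have omega_skew : skew_symmetric_form omega by apply/skewE.
have omega_nd : forall t, (forall u, omega t u = 0) -> t = 0.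
  apply: (tensor_form_radical0 _ _ _ _ _ T_tensor _ _ _ omegaE) => //.
  by case: nu_nondegenerate.
split=> //; first exact: (tensor_pre_lie _ _ _ _ _ T_tensor _ _ _ _ dotE).
(* Skew-symmetry of [omega] reduces the right radical to the left one. *)
by split=> // u u0; apply: omega_nd => t; rewrite omega_skew u0 oppr0.
Qed.
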